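(* Let $n\ge 1$ and let $k\ge 1$ be odd. Then $$\left|ASM^{-}_{n,k}\right|=\left(\prod_{p=0}^{n-1}\frac{(3p+1)!}{(n+p)!}\right)^{\frac{k+1}{2}}.$$
   Context: For $n,k\ge1$, $ASM^{-}_{n,k}$ (chained linear alternating sign matrices) is the set of $k$-tuples $(A^{(1)},\dots,A^{(k)})$ of $n\times n$ matrices with entries in $\{-1,0,1\}$ satisfying: (1) $\sum_{j=1}^m A^{(\ell)}_{i,j}\in\{0,1\}$ for all $1\le i\le n$, $1\le m\le n$, $1\le\ell\le k$; (2) $\sum_{j=1}^n A^{(\ell-1)}_{i,j}+\sum_{j=1}^m A^{(\ell)}_{n+1-j,i}\in\{0,1\}$ for all $1\le i\le n$, $1\le m\le n$, $1\le\ell\le k$, where $A^{(0)}$ is the zero matrix; (3) the sum of all entries $\sum_{i,j,\ell}A^{(\ell)}_{i,j}$ is maximum among all such $k$-tuples satisfying (1) and (2). *)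

(* Defs.v *)
From HB Require Import structures.
From mathcomp Require Import all_boot all_order all_algebra.

Set Implicit Arguments.
Unset Strict Implicit.
Unset Printing Implicit Defensive.

Import Order.TTheory GRing.Theory Num.Theory.
Local Open Scope ring_scope.

(* The entry set is a finite subtype of int, so that [#|_|] counts tuples. *)
Definition asm_entry : Type := seq_sub [:: -1 : int; 0; 1].
HB.instance Definition _ := SubFinite.on asm_entry.

(* Layers are numbered from 1: [layer A l] is A^(l) for 1 <= l <= k, and
   [layer A 0] is the zero matrix. *)
Definition layer (n k : nat) (A : k.-tuple 'M[asm_entry]_n) (l : nat) :
    'M[int]_n :=
  nth 0 (0 :: [seq map_mx (val : asm_entry -> int) M | M <- A]) l.

(* Rows and columns are numbered from 0, so m stands for the length m + 1 of
   the partial sums. *)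
Definition row_condition (n k : nat) (A : k.-tuple 'M[asm_entry]_n) : bool :=
  [forall l : 'I_k, forall i : 'I_n, forall m : 'I_n,
     \sum_(j < n | (j <= m)%N) layer A l.+1 i j \in [:: 0; 1]].

(* [rev_ord j] is row n + 1 - j in numbering from 1: the columns are read
   upwards, continuing the rows of the previous layer. *)
Definition column_condition (n k : nat) (A : k.-tuple 'M[asm_entry]_n) : bool :=
  [forall l : 'I_k, forall i : 'I_n, forall m : 'I_n,
     \sum_(j < n) layer A l i j
       + \sum_(j < n | (j <= m)%N) layer A l.+1 (rev_ord j) i \in [:: 0; 1]].

Definition chain_conditions (n k : nat) (A : k.-tuple 'M[asm_entry]_n) : bool :=
  row_condition A && column_condition A.

Definition total_sum (n k : nat) (A : k.-tuple 'M[asm_entry]_n) : int :=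
  \sum_(l < k) \sum_(i < n) \sum_(j < n) layer A l.+1 i j.

Definition linear_chained_ASM (n k : nat) : {set k.-tuple 'M[asm_entry]_n} :=
  [set A | chain_conditions A &
     [forall B : k.-tuple 'M[asm_entry]_n,
        chain_conditions B ==> (total_sum B <= total_sum A)]].

(* Main.v *)
(** Let T_l be the sum of the entries of the l-th layer. The two conditions give
    T_l + T_(l+1) <= n, so for odd k a maximal chain has T = n, 0, n, ..., n:
      its
    layers are alternately alternating sign matrices (read upwards) and zero,
    and only the number of n x n alternating sign matrices remains to be found.

    For this, view such a matrix as a state of the six-vertex model with domain
    wall boundary, at a primitive cube root of unity w (Kuperberg). By the
    Yang-Baxter equation the partition function Z is symmetric in the row
    parameters x_i, and at y = w^2 x the first row and column are frozen. By
    interpolation in y, Z is up to an explicit factor the Schur function of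
    (n-1, n-1, ..., 1, 1, 0, 0) in the 2n variables x_i, y_j, i.e. a quotient of
    two alternants (Okada, Stroganov). When the variables are the powers
    t^0, ..., t^(2n-1), both alternants are Vandermonde products in t, and at
    t = 1, where all vertex weights agree, the quotient yields the count. *)

Require Import Defs.
From mathcomp Require Import all_boot all_order all_algebra.
From mathcomp Require Import all_fingroup all_field ring zify.

Set Implicit Arguments.
Unset Strict Implicit.
Unset Printing Implicit Defensive.

Import Order.TTheory GRing.Theory Num.Theory.
Local Open Scope ring_scope.

(** * The six-vertex partition function *)

Lemma big_tuple_bool (R : nmodType) n (F : seq bool -> R) :
  \sum_(t : n.+1.-tuple bool) F t =
    \sum_(b : bool) \sum_(t : n.-tuple bool) F (b :: t).
Proof.
rewrite pair_big /=.
rewrite (reindex (fun p : bool * n.-tuple bool => [tuple of p.1 :: p.2])) //=.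
exists (fun t : n.+1.-tuple bool => (thead t, [tuple of behead t])).
  by case=> b t _; congr (_, _); apply: val_inj.
by move=> t _; rewrite /= -tuple_eta.
Qed.

Lemma big_tuple0 (R : nmodType) (F : seq bool -> R) :
  \sum_(t : 0.-tuple bool) F t = F [::].
Proof. by rewrite (big_pred1 [tuple]) // => t; rewrite [t]tuple0 /= eqxx. Qed.

Section SixVertex.

Variables (R : comNzRingType) (w : R).

(* A vertex has the incoming edges [h] (left) and [a] (below) and the outgoing
   edges [b] (above) and [g] (right); edges carry partial sums of the entries
   of the matrix, so that the entry at the vertex is [b - a = g - h]. *)
Definition vertex (x y : R) (h a b g : bool) : R :=
  match h, a, b, g with
  | false, false, false, false | true, true, true, true => w * x - w ^+ 2 * y
  | false, true, true, false | true, false, false, true => w * y - w ^+ 2 * x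
  | false, false, true, true => (w - w ^+ 2) * x
  | true, true, false, false => (w - w ^+ 2) * y
  | _, _, _, _ => 0
  end.

(** The final value [h%:R], like [all id s] in [partition_fun], is the domain wall boundary: every
    row and every column must end with partial sum 1. *)
Fixpoint row_weight (x : R) (ys : seq R) (h : bool) (s t : seq bool) : R :=
  match ys, s, t with
  | [::], [::], [::] => h%:R
  | y :: ys', a :: s', b :: t' =>
      \sum_(g : bool) vertex x y h a b g * row_weight x ys' g s' t'
  | _, _, _ => 0
  end.

Fixpoint partition_fun (xs ys : seq R) (s : seq bool) : R :=
  if xs is x :: xs' then
    \sum_(t : (size ys).-tuple bool)
      row_weight x ys false s t * partition_fun xs' ys t
  else (all id s)%:R.

Definition rmatrix (x1 x2 : R) (h g : bool * bool) : R :=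
  match h, g with
  | (false, false), (false, false) | (true, true), (true, true) => w * x2 - x1
  | (false, true), (false, true) => (w - 1) * x2
  | (true, false), (true, false) => (w - 1) * x1
  | (false, true), (true, false) | (true, false), (false, true) =>
      w ^+ 2 * (x1 - x2)
  | _, _ => 0
  end.

Definition double_vertex (x1 x2 y : R) (h : bool * bool) (a c : bool)
    (g : bool * bool) : R :=
  \sum_(b : bool) vertex x1 y h.1 a b g.1 * vertex x2 y h.2 b c g.2.

Definition double_row (x1 x2 : R) (ys : seq R) (h : bool * bool)
    (s u : seq bool) : R :=
  \sum_(t : (size ys).-tuple bool)
    row_weight x1 ys h.1 s t * row_weight x2 ys h.2 t u.

Lemma big_bool_pair (F : bool * bool -> R) :
  \sum_g F g = F (true, true) + F (true, false) + F (false, true)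
               + F (false, false).
Proof.
transitivity (\sum_(g : bool * bool) F (g.1, g.2)).
  by apply: eq_bigr => -[].
by rewrite -(pair_big xpredT xpredT (fun a b => F (a, b))) /= !big_bool /=
  addrA.
Qed.

Hypothesis w_root : w ^+ 2 + w + 1 = 0.

(** Pulling the crossing [rmatrix] of two horizontal lines through one column is a finite check over
    the edge states; each case is an identity modulo [w ^+ 2 = - w - 1]. *)
Lemma yang_baxter x1 x2 y h a c g :
  \sum_k rmatrix x1 x2 h k * double_vertex x1 x2 y k a c g =
  \sum_k double_vertex x2 x1 y h a c k * rmatrix x1 x2 k g.
Proof.
have w2 : w ^+ 2 = - w - 1 by rewrite -[LHS]subr0 -w_root; ring.
rewrite !big_bool_pair /double_vertex !big_bool /=.
by case: h => [] [] []; case: a; case: c; case: g => [] [] [] /=;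
  ring: w2.
Qed.

Lemma double_row_nil x1 x2 h :
  double_row x1 x2 [::] h [::] [::] = (h.1 && h.2)%:R.
Proof.
rewrite /double_row (big_tuple0 (fun t =>
  row_weight x1 [::] h.1 [::] t * row_weight x2 [::] h.2 t [::])) /=.
by rewrite -natrM mulnb.
Qed.

Lemma double_row_cons x1 x2 y ys h a s c u :
  double_row x1 x2 (y :: ys) h (a :: s) (c :: u) =
  \sum_g double_vertex x1 x2 y h a c g * double_row x1 x2 ys g s u.
Proof.
rewrite /double_row (big_tuple_bool _ (fun t =>
  row_weight x1 (y :: ys) h.1 (a :: s) t * row_weight x2 (y :: ys) h.2 t (c ::
    u))) /=.
under eq_bigr => b _ do
  [under eq_bigr => t _ do rewrite !big_bool /= mulrDl !mulrDr].
rewrite big_bool_pair /double_vertex !big_bool /= !mulrDl.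
rewrite !mulr_sumr -!big_split /=.
by apply: eq_bigr => t _; ring.
Qed.

(** Induction pulls the crossing through all columns to the right end, where only the state
    [(true, true)] survives and the crossing acts as the scalar [w * x2 - x1]. *)
Lemma double_row_intertwine x1 x2 ys h s u :
  size s = size ys -> size u = size ys ->
  \sum_g rmatrix x1 x2 h g * double_row x1 x2 ys g s u =
  (w * x2 - x1) * double_row x2 x1 ys h s u.
Proof.
elim: ys h s u => [|y ys IH] h [|a s] [|c u] //=.
  move=> _ _; rewrite big_bool_pair !double_row_nil.
  by case: h => [] [] [] /=; ring.
case=> sz_s [sz_u].
under eq_bigr => g _ do rewrite double_row_cons mulr_sumr.
rewrite exchange_big /= double_row_cons mulr_sumr.
under eq_bigr => g _ do
  [under eq_bigr => k _ do rewrite mulrA;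
    rewrite -mulr_suml yang_baxter mulr_suml].
rewrite exchange_big /=; apply: eq_bigr => k _.
under eq_bigr => g _ do rewrite -mulrA.
by rewrite -mulr_sumr IH // mulrCA.
Qed.

End SixVertex.

Section PartitionFunction.

Variables (R : idomainType) (w : R).
Hypothesis w_root : w ^+ 2 + w + 1 = 0.

(** At the left end both edges are empty; there the crossing acts as the same scalar as at the right
    end, and the two cancel. *)
Lemma partition_fun_swap x1 x2 xs ys s :
  size s = size ys -> w * x2 - x1 != 0 ->
  partition_fun w (x1 :: x2 :: xs) ys s =
  partition_fun w (x2 :: x1 :: xs) ys s.
Proof.
move=> sz_s nz.
have two_rows a b : partition_fun w (a :: b :: xs) ys s =
    \sum_(u : (size ys).-tuple bool)
      double_row w a b ys (false, false) s u * partition_fun w xs ys u.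
  rewrite /= /double_row.
  under eq_bigr => t _ do rewrite mulr_sumr.
  rewrite exchange_big; apply: eq_bigr => u _; rewrite mulr_suml.
  by apply: eq_bigr => t _; rewrite mulrA.
rewrite !two_rows; apply: eq_bigr => u _; congr (_ * _).
apply: (mulfI nz); rewrite -double_row_intertwine ?size_tuple //.
by rewrite big_bool_pair /= !mul0r !add0r.
Qed.

Lemma partition_fun_move x xs1 xs2 ys s :
  size s = size ys -> {in xs1, forall x', w * x - x' != 0} ->
  partition_fun w (xs1 ++ x :: xs2) ys s =
  partition_fun w (x :: xs1 ++ xs2) ys s.
Proof.
elim: xs1 s => [//|x' xs1 IH] s sz_s nz.
transitivity (partition_fun w (x' :: x :: xs1 ++ xs2) ys s).
  apply: eq_bigr => t _; congr (_ * _); apply: IH; first by rewrite size_tuple.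
  by move=> z zP; apply: nz; rewrite inE zP orbT.
by apply: partition_fun_swap; rewrite ?nz ?inE ?eqxx.
Qed.

(** An occupied horizontal edge meeting empty vertical ones goes straight on: an entry 1 would raise
    the row sum to 2, an entry -1 would make a column sum negative. *)
Lemma row_weight_frozen x ys t :
  row_weight w x ys true (nseq (size ys) false) t =
  (t == nseq (size ys) false)%:R * \prod_(y <- ys) (w * y - w ^+ 2 * x).
Proof.
elim: ys t => [|y ys IH] [|b t] /=; rewrite ?big_nil ?big_cons ?mul0r ?mulr1 //.
rewrite big_bool /= !IH; case: b => /=; rewrite ?mul0r ?addr0 //.
by rewrite eqseq_cons /= mulrCA.
Qed.

(** Only empty edges enter the first column from the left, so once its sum is 1, all its later
    entries are 0. *)
Lemma partition_fun_column y xs ys s :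
  partition_fun w xs (y :: ys) (true :: s) =
  \prod_(x <- xs) (w * y - w ^+ 2 * x) * partition_fun w xs ys s.
Proof.
elim: xs s => [|x xs IH] s /=; first by rewrite big_nil mul1r.
rewrite (big_tuple_bool _ (fun t =>
  row_weight w x (y :: ys) false (true :: s) t
    * partition_fun w xs (y :: ys) t)) big_bool /=.
rewrite [X in _ + X]big1 ?addr0 => [|t _]; last first.
  by rewrite big_bool /= !mul0r addr0 mul0r.
rewrite big_cons mulr_sumr; apply: eq_bigr => t _.
by rewrite big_bool /= mul0r add0r IH; ring.
Qed.

(* The corner vertex is forced to carry an entry 1, which fixes the rest of the
   first row and of the first column. *)
Lemma partition_fun_frozen x y xs ys :
  w * x = w ^+ 2 * y ->
  partition_fun w (x :: xs) (y :: ys) (nseq (size ys).+1 false) =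
  (w - w ^+ 2) * x * \prod_(y' <- ys) (w * y' - w ^+ 2 * x)
    * \prod_(x' <- xs) (w * y - w ^+ 2 * x')
    * partition_fun w xs ys (nseq (size ys) false).
Proof.
move=> corner /=.
rewrite (big_tuple_bool _ (fun t =>
  row_weight w x (y :: ys) false (false :: nseq (size ys) false) t
    * partition_fun w xs (y :: ys) t)) big_bool /=.
rewrite [X in _ + X]big1 ?addr0 => [|t _]; last first.
  by rewrite big_bool /= corner subrr !mul0r addr0 mul0r.
rewrite (bigD1 [tuple of nseq (size ys) false]) //= [X in _ + X]big1 ?addr0 =>
  [|t neq].
  rewrite big_bool /= mul0r addr0 row_weight_frozen eqxx mul1r.
  by rewrite partition_fun_column; ring.
rewrite big_bool /= mul0r addr0 row_weight_frozen.
by rewrite (_ : (_ == _) = false) ?mul0r ?mulr0 ?mul0r //; apply: negbTE.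
Qed.

End PartitionFunction.

(** * Change of ring, and the degree in a column variable *)

Lemma rmorph_vertex (R S : comNzRingType) (f : {rmorphism R -> S}) w x y h a b g
  :
  f (vertex w x y h a b g) = vertex (f w) (f x) (f y) h a b g.
Proof.
by case: h a b g => [] [] [] [] /=;
  rewrite ?rmorph0 ?rmorphB ?rmorphM ?rmorphB ?rmorphXn.
Qed.

Lemma rmorph_row_weight (R S : comNzRingType) (f : {rmorphism R -> S}) w x ys h
  s t :
  f (row_weight w x ys h s t) = row_weight (f w) (f x) (map f ys) h s t.
Proof.
elim: ys h s t => [|y ys IH] h [|a s] [|b t] /=;
  rewrite ?rmorph0 ?rmorph_nat //.
rewrite rmorph_sum; apply: eq_bigr => g _.
by rewrite rmorphM /= rmorph_vertex IH.
Qed.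

Lemma rmorph_partition_fun (R S : comNzRingType) (f : {rmorphism R -> S}) w xs
  ys s :
  f (partition_fun w xs ys s) = partition_fun (f w) (map f xs) (map f ys) s.
Proof.
elim: xs s => [|x xs IH] s /=; first by rewrite rmorph_nat.
rewrite rmorph_sum size_map; apply: eq_bigr => t _.
by rewrite rmorphM /= rmorph_row_weight IH.
Qed.

Lemma size_polyD_leq (R : nzRingType) (p q : {poly R}) k :
  (size p <= k)%N -> (size q <= k)%N -> (size ((p + q))%R <= k)%N.
Proof. by move=> pk qk; rewrite (leq_trans (size_polyD _ _)) ?geq_max ?pk. Qed.

Lemma size_polyM_leq (R : nzRingType) (p q : {poly R}) i j :
  (size p <= i.+1)%N -> (size q <= j)%N -> (size ((p * q))%R <= i + j)%N.
Proof.
move=> pi qj; rewrite (leq_trans (size_polyMleq _ _)) //.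
by rewrite -subn1 leq_subLR addnA add1n leq_add.
Qed.

(* Each row contributes a factor of degree at most 1 in the first column
   variable, except for the entry 1, which has degree 0. *)
Lemma size_partition_fun (R : idomainType) (w : R) xs ys a s :
  (size (partition_fun w%:P (map polyC xs) ('X :: map polyC ys) (a :: s))
    <= size xs + a)%N.
Proof.
elim: xs a s => [|x xs IH] a s /=.
  by case: a => /=; [case: all|]; rewrite ?size_poly0 ?size_poly1.
have const_row g t :
    (size (row_weight w%:P x%:P (map polyC ys) g s t) <= 1)%N.
  by rewrite -rmorph_row_weight size_polyC leq_b1.
have zero_le k : (size (0 : {poly R})%R <= k)%N by rewrite size_poly0.
have const1 (c d : {poly R}) : (size c <= 1)%N -> (size d <= 1)%N ->
    (size ((c * d))%R <= 1)%N by apply: (@size_polyM_leq _ _ _ 0).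
have linear (c d : R) : (size ((c%:P * 'X - d%:P))%R <= 2)%N.
  apply: size_polyD_leq; last by rewrite size_polyN size_polyC (leq_trans
    (leq_b1 _)).
  by apply: (@size_polyM_leq _ _ _ 0); rewrite ?size_polyC ?leq_b1 ?size_polyX.
rewrite (big_tuple_bool _ (fun t =>
  row_weight w%:P x%:P ('X :: map polyC ys) false (a :: s) t
    * partition_fun w%:P (map polyC xs) ('X :: map polyC ys) t)).
rewrite big_bool /=.
have sum_le k (F : (size (map polyC ys)).-tuple bool -> {poly R}) :
    (forall t, size (F t) <= k)%N -> (size (\sum_t F t)%R <= k)%N.
  move=> Fk; apply: (big_ind (fun p : {poly R} => size p <= k)%N) => // p q.
  exact: size_polyD_leq.
rewrite -rmorphXn -!rmorphM /= -rmorphB -!rmorphM.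
apply: size_polyD_leq; apply: sum_le => t; rewrite big_bool /=;
  case: a => /=; rewrite ?mul0r ?addr0 ?add0r ?mul0r //.
- rewrite -addn1 addSn -addnS -add1n.
  apply: leq_trans (size_polyM_leq (_ : _ <= 2)%N (IH _ _)) _ => //.
  have lin := linear w (w ^+ 2 * x); rewrite -!mulrA in lin *.
  by apply: leq_trans (size_polyM_leq lin (const_row _ _)) _.
- apply: leq_trans (size_polyM_leq (_ : _ <= 1)%N (IH _ _)) _; last first.
    by rewrite add0n addn1 addn0.
  by apply: const1 => //; rewrite size_polyC leq_b1.
apply: leq_trans (size_polyM_leq (_ : _ <= 2)%N (IH _ _)) _; last first.
  by rewrite add1n addn0 addn0.
apply: leq_trans (size_polyM_leq (_ : _ <= 2)%N (const_row _ _)) _ => //.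
rewrite -opprB size_polyN; exact: linear.
Qed.

(** * Alternants *)

Definition alternant_mx (R : pzRingType) (f : nat -> nat) (zs : seq R) :
    'M[R]_(size zs) :=
  \matrix_(i, j) zs`_i ^+ f j.

Definition alternant (R : comPzRingType) (f : nat -> nat) (zs : seq R) : R :=
  \det (alternant_mx f zs).

Lemma alternant_tuple (R : comPzRingType) f n (t : n.-tuple R) :
  alternant f t = \det (\matrix_(i < n, j < n) t`_i ^+ f j).
Proof.
rewrite /alternant /alternant_mx; case: t => s sz /=.
by move: (sz) => /eqP sz'; case: _ / sz' in sz *.
Qed.

(** The sign is chosen before [f], so it is common to the two alternants of an identity and
    cancels. *)
Lemma alternant_perm (R : comPzRingType) (zs zs' : seq R) :
  perm_eq zs zs' ->
  exists b : bool, forall f, alternant f zs = (-1) ^+ b * alternant f zs'.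
Proof.
move=> pzz; have sz := perm_size pzz.
have [s zs_def] := tuple_permP (t := in_tuple zs') pzz.
exists (odd_perm s) => f.
rewrite zs_def alternant_tuple.
rewrite -[alternant f zs']/(alternant f (in_tuple zs')) alternant_tuple.
rewrite -det_perm -det_mulmx -row_permE; congr (\det _).
by apply/matrixP => i j; rewrite !mxE -tnth_nth tnth_mktuple (tnth_nth 0).
Qed.

Lemma alternant_dup (R : comPzRingType) f (z : R) zs :
  z \in zs -> alternant f (z :: zs) = 0.
Proof.
move=> zP; have iP : ((index z zs).+1 < size (z :: zs))%N.
  by rewrite /= ltnS index_mem.
rewrite /alternant.
apply: (determinant_alternate (i1 := ord0) (i2 := Ordinal iP)) => // j.
by rewrite !mxE /= nth_index.
Qed.

Lemma rmorph_alternant (R S : comPzRingType) (g : {rmorphism R -> S}) f zs :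
  alternant f (map g zs) = g (alternant f zs).
Proof.
rewrite -[map g zs]/(tval (map_tuple g (in_tuple zs))) alternant_tuple.
rewrite /alternant -det_map_mx; congr (\det _).
by apply/matrixP => i j; rewrite !mxE /= (nth_map 0) // rmorphXn.
Qed.

Lemma alternant_id_cons (R : comPzRingType) (z : R) zs :
  alternant id (z :: zs) = \prod_(z' <- zs) (z' - z) * alternant id zs.
Proof.
have alt_id s : alternant id s =
    \prod_(i < size s) \prod_(j < size s | (i < j)%N) (s`_j - s`_i) :> R.
  transitivity (\det (Vandermonde (size s) (\row_(i < size s) s`_i))).
    by rewrite -det_tr; congr (\det _); apply/matrixP => i j; rewrite !mxE.
  rewrite det_Vandermonde; apply: eq_bigr => i _.
  by apply: eq_bigr => j _; rewrite !mxE.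
rewrite !alt_id /= big_ord_recl; congr (_ * _).
  by rewrite [RHS](big_nth 0) big_mkord [LHS]big_mkcond big_ord_recl /= mul1r.
apply: eq_bigr => i _.
by rewrite big_mkcond big_ord_recl /= mul1r [RHS]big_mkcond.
Qed.

(** The exponents 0, 1, 3, 4, 6, 7, ...: the staircase plus the partition with parts 0, 0, 1, 1, 2,
    2, .... Hence [alternant expo] divided by [alternant id] is the Schur function of the double
    staircase. *)
Definition expo (j : nat) : nat := j + j./2.

(* Subtracting [x ^+ 3] times column [j - 2] from column [j] kills the first two
   rows outside the first two columns, because the exponents grow by 3 when
   [j] grows by 2. *)
Lemma alternant_expo_cons2 (R : comPzRingType) (y x : R) zs :
  y ^+ 3 = x ^+ 3 ->
  alternant expo (y :: x :: zs) =
  (x - y) * \prod_(z <- zs) (z ^+ 3 - x ^+ 3) * alternant expo zs.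
Proof.
move=> y3.
pose n := size zs.
pose shift : 'M[R]_(2 + n) :=
  \matrix_(i, j) ((i == j)%:R - x ^+ 3 * (j == i.+2 :> nat)%:R).
have det_shift : \det shift = 1.
  rewrite -det_tr det_trig.
    rewrite big1 // => i _; rewrite !mxE eqxx.
    by rewrite (_ : (_ == _ :> nat) = false) ?mulr0 ?subr0 //; lia.
  apply/is_trig_mxP => i j lt_ij; rewrite !mxE.
  rewrite (_ : (j == i) = false); last by apply/negbTE; rewrite -val_eqE /=;
    lia.
  by rewrite (_ : (_ == _ :> nat) = false) ?mulr0 ?subr0 //; lia.
pose head : 'M[R]_2 := \matrix_(i, j) [:: y; x]`_i ^+ j.
pose diag : 'rV[R]_n := \row_i (zs`_i ^+ 3 - x ^+ 3).
have -> : alternant expo (y :: x :: zs) =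
    \det (block_mx head 0 (\matrix_(i < n, j < 2) zs`_i ^+ j)
            (diag_mx diag *m alternant_mx expo zs)).
  pose mx : 'M[R]_(2 + n) := alternant_mx expo (y :: x :: zs).
  rewrite -[LHS]mulr1 -det_shift -[LHS](det_mulmx mx); congr (\det _).
  have shift_l (r : 'I_(2 + n) -> R) (j : 'I_2) :
      \sum_k r k * shift k (lshift n j) = r (lshift n j).
    rewrite (bigD1 (lshift n j)) //= big1 ?addr0 => [|k kj]; rewrite !mxE.
      by rewrite eqxx (_ : (_ == _ :> nat) = false) ?mulr0 ?subr0 ?mulr1 //=;
        lia.
    rewrite (negbTE kj) (_ : (_ == _ :> nat) = false) ?mulr0 ?subr0 ?mulr0 //=.
    by have := ltn_ord j; lia.
  have shift_r (r : 'I_(2 + n) -> R) (j : 'I_n) :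
      \sum_k r k * shift k (rshift 2 j) =
      r (rshift 2 j) - x ^+ 3 * r (widen_ord (leq_addl 2 n) j).
    under eq_bigr => k _ do rewrite mxE mulrBr.
    rewrite sumrB; congr (_ - _).
      rewrite (bigD1 (rshift 2 j)) //= eqxx mulr1 big1 ?addr0 // => k kj.
      by rewrite (negbTE kj) mulr0.
    rewrite (bigD1 (widen_ord (leq_addl 2 n) j)) //= eqxx mulr1 mulrC.
    rewrite big1 ?addr0 // => k; rewrite -val_eqE /= => kj.
    by rewrite (_ : (_ == _) = false) ?mulr0 //; lia.
  have expoD2 j : expo (2 + j) = (3 + expo j)%N by rewrite /expo /=; lia.
  apply/matrixP => i j; rewrite [LHS]mxE.
  case: (split_ordP i) => {}i ->; case: (split_ordP j) => {}j ->;
    rewrite ?shift_l ?shift_r ?block_mxEul ?block_mxEur ?block_mxEdl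
      ?block_mxEdr !mxE.
  - by case: i => [[|[|]]] //= _; case: j => [[|[|]]].
  - rewrite expoD2 /= exprD; case: i => [[|[|]]] //= _;
      first by rewrite y3 subrr.
    by rewrite subrr.
  - by case: j => [[|[|]]].
  - rewrite (bigD1 i) //= big1 ?addr0 => [|k ki]; last first.
      by rewrite !mxE eq_sym (negbTE ki) mul0r.
    by rewrite !mxE eqxx mulr1n expoD2 exprD mulrBl.
rewrite det_lblock det_mulmx det_diag mulrA; congr (_ * _ * _).
  rewrite (expand_det_row _ ord0) !big_ord_recl big_ord0 /cofactor !det_mx11.
  by rewrite !mxE /= /bump /=; ring.
rewrite [RHS](big_nth 0) big_mkord; apply: eq_bigr => i _; by rewrite !mxE.
Qed.

(** * Interpolation *)

Lemma prodrMl_size (R : comNzRingType) (T : Type) (c : R) (F : T -> R) s :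
  \prod_(z <- s) (c * F z) = c ^+ size s * \prod_(z <- s) F z.
Proof. by rewrite big_split big_const_seq count_predT iter_mulr_1. Qed.

(** Expansion along the first row, the only one that contains ['X]; the cofactors are constants. *)
Lemma size_alternant (R : idomainType) f (zs : seq R) d :
  (forall j, (j <= size zs)%N -> (f j <= d)%N) ->
  (size (alternant f ('X :: map polyC zs)) <= d.+1)%N.
Proof.
move=> fd; rewrite /alternant (expand_det_row _ ord0).
apply: (big_ind (fun p : {poly R} => size p <= d.+1)%N);
  first by rewrite size_poly0.
  by move=> p q; exact: size_polyD_leq.
move=> j _; rewrite -[d.+1]addn1; apply: size_polyM_leq.
  rewrite !mxE /= size_polyXn ltnS; apply: fd.
  rewrite -ltnS -[size zs](size_map polyC); exact: ltn_ord.
rewrite /cofactor; set M := row' _ _.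
(* The leading [0] of the list merely fills the place of the deleted row. *)
have -> : M = map_mx polyC
    (row' ord0 (col' j (\matrix_(i, k) (0 :: zs)`_i ^+ f k))).
  apply/matrixP => i k; rewrite !mxE /= rmorphXn; congr (_ ^+ _).
  by rewrite (nth_map 0) // -(size_map polyC zs) ltn_ord.
rewrite det_map_mx -(rmorph_sign (polyC : {rmorphism R -> {poly R}})) -rmorphM
  size_polyC.
exact: leq_b1.
Qed.

Section Interpolation.

Variables (R : idomainType) (w : R).
Hypothesis w_root : w ^+ 2 + w + 1 = 0.

Let w3 : w ^+ 3 = 1.
Proof.
by apply/eqP; rewrite -subr_eq0; apply/eqP;
  rewrite -[RHS](mulr0 (w - 1)) -w_root; ring.
Qed.

(** Passing from [n] to [n.+1] at a frozen corner contributes [w - w ^+ 2] and the sign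
    [(-1) ^+ n]. *)
Definition alternant_const n : R := (w - w ^+ 2) ^+ n * (-1) ^+ 'C(n, 2).

Lemma partition_alternant_frozen n x xs ys :
  size xs = n -> size ys = n ->
  partition_fun w xs ys (nseq n false) * alternant id (ys ++ xs) =
    alternant_const n * \prod_(x' <- xs) x' * alternant expo (ys ++ xs) ->
  let y := w ^+ 2 * x in
  partition_fun w (x :: xs) (y :: ys) (nseq n.+1 false)
    * alternant id (y :: x :: ys ++ xs) =
  alternant_const n.+1 * \prod_(x' <- x :: xs) x'
    * alternant expo (y :: x :: ys ++ xs).
Proof.
move=> sz_xs sz_ys IH y.
have wy : w * y = x by rewrite mulrA -exprS w3 mul1r.
have corner : w * x = w ^+ 2 * y by rewrite exprS expr1 -mulrA wy.
rewrite -[in nseq _ _]sz_ys (partition_fun_frozen _ _ corner) sz_ys.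
rewrite !alternant_id_cons big_cons alternant_expo_cons2; last first.
  by rewrite exprMn -exprM (exprM w 3 2) w3 expr1n mul1r.
have row_col : \prod_(y' <- ys) (w * y' - w ^+ 2 * x)
      * \prod_(x' <- xs) (w * y - w ^+ 2 * x') =
    (-1) ^+ n * \prod_(z <- ys ++ xs) (z - w * x).
  (* Row and column each have [n] such factors, and [w * (- w ^+ 2) = -1]; hence the sign
     [(-1) ^+ n]. *)
  have row_factor y' : w * y' - w ^+ 2 * x = w * (y' - w * x) by ring.
  have col_factor x' : w * y - w ^+ 2 * x' = - w ^+ 2 * (x' - w * x).
    by rewrite /y; ring.
  rewrite (eq_bigr _ (fun y' _ => row_factor y')).
  rewrite [X in _ * X = _](eq_bigr _ (fun x' _ => col_factor x')).
  rewrite !prodrMl_size sz_xs sz_ys mulrACA -exprMn big_cat /=.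
  by rewrite mulrN -exprS w3.
have cubes : \prod_(z <- ys ++ xs) (z ^+ 3 - x ^+ 3) =
    \prod_(z <- ys ++ xs) (z - y) * \prod_(z <- ys ++ xs) (z - x)
      * \prod_(z <- ys ++ xs) (z - w * x).
  rewrite -!big_split /=; apply: eq_bigr => z _.
  have w2 : w ^+ 2 = - w - 1 by rewrite -[LHS]subr0 -w_root; ring.
  by rewrite /y; ring: w2.
rewrite big_cons cubes /alternant_const binS bin1 exprD (exprS _ n).
move: row_col IH; rewrite /alternant_const.
set py := \prod_(y' <- ys) _; set px := \prod_(x' <- xs) (_ - _).
set pz := \prod_(z <- _) (z - w * x); set pzy := \prod_(z <- _) (z - y).
set pzx := \prod_(z <- _) (z - x).
set Z := partition_fun _ _ _ _; set D := alternant expo _.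
set V := alternant id _.
move=> row_col IH.
transitivity ((w - w ^+ 2) * x * (py * px) * (x - y) * pzy * pzx * (Z * V)).
  by ring.
by rewrite row_col IH; ring.
Qed.

Lemma partition_alternant_step n xs ys y :
  size xs = n.+1 -> size ys = n ->
  uniq (ys ++ xs ++ map ( *%R (w ^+ 2)) xs) ->
  (forall xs1 x xs2, xs = xs1 ++ x :: xs2 ->
     partition_fun w (xs1 ++ xs2) ys (nseq n false)
       * alternant id (ys ++ xs1 ++ xs2) =
     alternant_const n * \prod_(x' <- xs1 ++ xs2) x'
       * alternant expo (ys ++ xs1 ++ xs2)) ->
  partition_fun w xs (y :: ys) (nseq n.+1 false)
    * alternant id (y :: ys ++ xs) =
  alternant_const n.+1 * \prod_(x <- xs) x * alternant expo (y :: ys ++ xs).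
Proof.
move=> sz_xs sz_ys uniq_z IH.
pose C := alternant_const n.+1 * \prod_(x <- xs) x.
pose F : {poly R} :=
  partition_fun w%:P (map polyC xs) ('X :: map polyC ys) (nseq n.+1 false)
    * alternant id ('X :: map polyC (ys ++ xs))
  - C%:P * alternant expo ('X :: map polyC (ys ++ xs)).
have F_eval z : F.[z] =
    partition_fun w xs (z :: ys) (nseq n.+1 false) * alternant id (z :: ys ++
      xs)
    - C * alternant expo (z :: ys ++ xs).
  have evalC s : map (horner_eval z) (map polyC s) = s.
    by rewrite -map_comp map_id_in // => u _ /=; rewrite /horner_eval hornerC.
  have evalX : horner_eval z 'X = z by rewrite /horner_eval hornerX.
  rewrite -[F.[z]]/(horner_eval z F) rmorphB !rmorphM rmorph_partition_fun.
  rewrite -!rmorph_alternant /= !evalC evalX.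
  by rewrite /horner_eval !hornerC.
(* The degree is at most 3n + 1, which is n + (2n + 1) for the first product and [expo] of 2n + 1
   for the second, against 3n + 2 roots. *)
have size_F : (size F <= size (ys ++ xs ++ map ( *%R (w ^+ 2)) xs))%N.
  have -> : size (ys ++ xs ++ map ( *%R (w ^+ 2)) xs) = (n + n.+1 + n.+1)%N.
    by rewrite !size_cat size_map sz_xs sz_ys addnA.
  apply: size_polyD_leq.
    apply: leq_trans (size_polyM_leq (_ : _ <= n.+1)%N (_ : _ <= n.*2.+2)%N) _.
    - by have := size_partition_fun w xs ys false (nseq n false);
        rewrite sz_xs addn0.
    - by apply: size_alternant => j; rewrite size_cat sz_xs sz_ys; lia.
    - by lia.
  rewrite size_polyN.
  apply: leq_trans (size_polyM_leq (_ : _ <= 1)%N (_ : _ <= (n * 3).+2)%N) _.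
  - by rewrite size_polyC leq_b1.
  - by apply: size_alternant => j; rewrite size_cat sz_xs sz_ys /expo; lia.
  - by lia.
suff F0 : F = 0 by apply/eqP; rewrite -subr_eq0 -F_eval F0 horner0.
apply: contraTeq size_F => nzF; rewrite -ltnNge.
apply: max_poly_roots => //; apply/allP => z; rewrite catA mem_cat => /orP[].
  by rewrite rootE F_eval => zP; rewrite !alternant_dup // !mulr0 subrr.
move=> /mapP[x xP ->]; rewrite rootE F_eval subr_eq0 /C.
(* From [w * x = x'] would follow [x = w ^+ 2 * x'], a repetition in the list of roots. *)
have nz x' : x' \in xs -> w * x - x' != 0.
  move=> x'P; rewrite subr_eq0; apply: contraTneq uniq_z => wx.
  rewrite cat_uniq cat_uniq (_ : has _ (map _ xs)) ?andbF //.
  apply/hasP; exists x => //; apply/mapP; exists x' => //.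
  by rewrite -wx mulrA -exprSr w3 mul1r.
case/splitPr: xP IH sz_xs nz => xs1 xs2 IH sz_xs nz.
have sz_xs12 : size (xs1 ++ xs2) = n.
  by move: sz_xs; rewrite !size_cat /= addnS => -[].
have [b flip] : exists b : bool, forall f,
    alternant f (w ^+ 2 * x :: ys ++ xs1 ++ x :: xs2) =
    (-1) ^+ b * alternant f (w ^+ 2 * x :: x :: ys ++ xs1 ++ xs2).
  by apply: alternant_perm; rewrite perm_cons !catA -cat1s perm_catCA.
have := partition_alternant_frozen x sz_xs12 sz_ys (IH _ _ _ erefl).
rewrite !flip partition_fun_move ?size_nseq /= ?sz_ys //; last first.
  by move=> x' x'P; apply: nz; rewrite mem_cat x'P.
have -> : \prod_(x' <- xs1 ++ x :: xs2) x' = \prod_(x' <- x :: xs1 ++ xs2) x'.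
  by apply: perm_big; rewrite -cat1s perm_catCA.
by move=> frozen; rewrite mulrCA frozen [X in _ == X]mulrCA.
Qed.

(** Nothing is assumed about [y]; in the induction the head of [ys] takes over its part. *)
Lemma partition_alternant n xs ys y :
  size xs = n.+1 -> size ys = n ->
  uniq (ys ++ xs ++ map ( *%R (w ^+ 2)) xs) ->
  partition_fun w xs (y :: ys) (nseq n.+1 false)
    * alternant id (y :: ys ++ xs) =
  alternant_const n.+1 * \prod_(x <- xs) x * alternant expo (y :: ys ++ xs).
Proof.
elim: n xs ys y => [|n IH] xs ys y sz_xs sz_ys uniq_z;
  apply: partition_alternant_step => // xs1 x xs2 xs_def.
  move: sz_xs; rewrite xs_def size_cat addnS => -[] /eqP.
  rewrite addn_eq0 !size_eq0 => /andP[/eqP-> /eqP->].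
  rewrite (size0nil sz_ys) /alternant_const /= big_nil /alternant !det_mx00.
  by rewrite bin0n !expr0 !mulr1.
have sz_xs12 : size (xs1 ++ xs2) = n.+1.
  by move: sz_xs; rewrite xs_def !size_cat /= addnS => -[].
case: ys sz_ys uniq_z => // y' ys [sz_ys] uniq_z.
apply: IH => //.
have sub_xs : subseq (xs1 ++ xs2) xs.
  by rewrite xs_def; apply: cat_subseq => //; apply: subseq_cons.
apply: subseq_uniq uniq_z.
apply: (cat_subseq (s3 := y' :: ys)); first exact: subseq_cons.
by apply: cat_subseq => //; apply: map_subseq.
Qed.

End Interpolation.

(** * Principal specialization *)

(** What remains at t = 1 of a Vandermonde product in the powers [t ^+ f i] once each factor is
    divided by t - 1. Truncated subtraction is exact for the monotone [f] in use. *)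
Definition gap_prod (f : nat -> nat) n : nat :=
  (\prod_(i < n) \prod_(j < n | i < j) (f j - f i))%N.

Section Specialization.

Variables (R : idomainType) (w : R).
Hypotheses (w_root : w ^+ 2 + w + 1 = 0) (w2_neq1 : w ^+ 2 != 1).

Definition pair_prod (S : pzRingType) (F : nat -> nat -> S) n : S :=
  \prod_(i < n) \prod_(j < n | (i < j)%N) F i j.

Let powers (s : seq nat) : seq {poly R} := [seq 'X^i | i <- s].

(** Since [('X^i) ^+ f j = ('X^(f j)) ^+ i], the alternant is also a Vandermonde determinant in the
    ['X^(f j)]. *)
Lemma alternant_powers f n :
  alternant f (powers (iota 0 n)) =
  pair_prod (fun i j => 'X^(f j) - 'X^(f i) : {poly R}) n.
Proof.
have sz : size (powers (iota 0 n)) == n by rewrite size_map size_iota.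
rewrite -[powers _]/(tval (Tuple sz)) alternant_tuple.
transitivity (\det (Vandermonde n (\row_(j < n) ('X^(f j) : {poly R})))).
  congr (\det _); apply/matrixP => i j; rewrite !mxE /=.
  by rewrite (nth_map 0%N) ?size_iota // nth_iota // add0n -!exprM mulnC.
rewrite det_Vandermonde; apply: eq_bigr => i _.
by apply: eq_bigr => j _; rewrite !mxE.
Qed.

(** Each pair yields one factor ['X - 1], whatever [f] is; these factors cancel between the two
    alternants, and the geometric sums left over take the gaps as values at 1. *)
Lemma pair_prod_powers f n :
  {homo f : i j / (i <= j)%N} ->
  exists Q : {poly R},
    alternant f (powers (iota 0 n)) = pair_prod (fun _ _ => 'X - 1) n * Q /\
    Q.[1] = (gap_prod f n)%:R.
Proof.
move=> f_homo.
pose q i j : {poly R} := 'X^(f i) * \sum_(k < f j - f i) 'X^k.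
exists (pair_prod q n); split.
  rewrite alternant_powers -big_split /=; apply: eq_bigr => i _.
  rewrite -big_split /=; apply: eq_bigr => j lt_ij.
  rewrite /q mulrCA -subrX1 mulrBr mulr1 -exprD subnKC //.
  by apply: f_homo; apply: ltnW.
rewrite horner_prod natr_prod; apply: eq_bigr => i _.
rewrite horner_prod natr_prod; apply: eq_bigr => j _.
rewrite hornerM hornerXn expr1n mul1r horner_sum.
rewrite (eq_bigr (fun => 1)) => [|k _]; last by rewrite hornerXn expr1n.
by rewrite sumr_const card_ord.
Qed.

Lemma uniq_powers s1 s2 :
  uniq (s1 ++ s2) ->
  uniq (powers s1 ++ powers s2 ++ map ( *%R (w%:P ^+ 2)) (powers s2)).
Proof.
have powers_inj : injective (fun i => 'X^i : {poly R}).
  move=> i j /(congr1 (fun p : {poly R} => p`_j)); rewrite !coefXn eqxx.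
  by case: eqP => // _ /eqP; rewrite eq_sym oner_eq0.
move=> uniq_s; rewrite catA cat_uniq -map_cat map_inj_uniq // uniq_s /=.
move: uniq_s; rewrite cat_uniq => /and3P[_ _ uniq_s2].
have wP_neq0 : w%:P ^+ 2 != 0 :> {poly R}.
  rewrite -rmorphXn polyC_eq0 expf_eq0 /=;
    apply: contraNneq (oner_neq0 R) => w0.
  by rewrite -w_root w0 expr0n !add0r.
rewrite map_inj_uniq ?map_inj_uniq ?uniq_s2 ?andbT //; last exact: mulfI.
apply/hasPn => p /mapP[_ /mapP[j _ ->] ->]; apply/mapP => -[i _].
rewrite -rmorphXn => /(congr1 (fun p : {poly R} => p`_i)).
rewrite coefCM !coefXn eqxx; case: eqP => _ /eqP.
  by rewrite mulr1 (negbTE w2_neq1).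
by rewrite mulr0 eq_sym oner_eq0.
Qed.

(** The column variables become ['X^0] to ['X^(n - 1)] and the row variables the next [n] powers;
    after cancellation of the factors ['X - 1], all are evaluated at 1. *)
Lemma partition_fun_ones n :
  partition_fun w (nseq n 1) (nseq n 1) (nseq n false)
    * (gap_prod id n.*2)%:R =
  alternant_const w n * (gap_prod expo n.*2)%:R.
Proof.
case: n => [|n].
  by rewrite /gap_prod /alternant_const !big_ord0 bin0n !expr0 !mulr1.
have homo_expo : {homo expo : i j / (i <= j)%N}.
  by move=> i j; rewrite /expo; lia.
have [V [altV V1]] := @pair_prod_powers id n.+1.*2 (fun _ _ => id).
have [D [altD D1]] := @pair_prod_powers expo n.+1.*2 homo_expo.
have wP_root : w%:P ^+ 2 + w%:P + 1 = 0 :> {poly R}.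
  by rewrite -rmorphXn -[1]/(1%:P) -!rmorphD w_root.
have := @partition_alternant _ _ wP_root n (powers (iota n.+1 n.+1))
  (powers (iota 1 n)) ('X^0).
rewrite !size_map !size_iota => /(_ erefl erefl).
have -> : 'X^0 :: powers (iota 1 n) ++ powers (iota n.+1 n.+1) =
    powers (iota 0 n.+1.*2).
  by rewrite -addnn iotaD /powers map_cat.
rewrite altV altD.
have P_neq0 : pair_prod (fun _ _ => 'X - 1 : {poly R}) n.+1.*2 != 0.
  apply/prodf_neq0 => i _; apply/prodf_neq0 => j _;
    by rewrite -[1]/(1%:P) polyXsubC_eq0.
have uniq_s : uniq (iota 1 n ++ iota n.+1 n.+1).
  by have := iota_uniq 1 (n + n.+1); rewrite iotaD add1n.
move=> /(_ (uniq_powers uniq_s)) /esym; rewrite mulrCA [RHS]mulrCA =>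
  /(mulfI P_neq0).
pose ev : {rmorphism {poly R} -> R} := horner_eval 1.
move=> /(congr1 ev) /esym.
have ones s : map ev (powers s) = nseq (size s) 1.
  by elim: s => //= i s ->; rewrite /ev /= /horner_eval hornerXn expr1n.
have ones_s : 'X^0 :: powers (iota 1 n) = powers (iota 0 n.+1) by [].
have eval_w : ev w%:P = w by rewrite /ev /= /horner_eval hornerC.
have eval_const : ev (alternant_const w%:P n.+1) = alternant_const w n.+1.
  by rewrite /alternant_const rmorphM !rmorphXn rmorphB rmorphXn eval_w
    rmorphN1.
have eval_prod s : ev (\prod_(x <- powers s) x) = 1.
  rewrite rmorph_prod big_map big1 // => i _.
  by rewrite /ev /= /horner_eval hornerXn expr1n.
have eval_V := V1 : ev V = _; have eval_D := D1 : ev D = _.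
move: (alternant_const w%:P n.+1) eval_const => C eval_const.
rewrite ones_s !rmorphM rmorph_partition_fun !ones !size_iota.
by rewrite eval_const eval_prod eval_w eval_V eval_D mulr1 mulrC.
Qed.

End Specialization.

(** * Gap products in terms of factorials *)

Section GapProducts.

Local Open Scope nat_scope.

Lemma gap_prodS f n :
  gap_prod f n.+1 = gap_prod f n * \prod_(i < n) (f n - f i).
Proof.
rewrite /gap_prod big_ord_recr /= [X in _ * X]big1 ?muln1 => [|j]; last first.
  by rewrite ltnNge -ltnS ltn_ord.
rewrite -big_split /=; apply: eq_bigr => i _.
by rewrite [LHS]big_mkcond big_ord_recr /= ltn_ord -big_mkcond.
Qed.

Lemma gap_prod_idS n : gap_prod id n.+1 = gap_prod id n * n`!.
Proof.
rewrite gap_prodS; congr (_ * _).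
elim: n => [|n IH]; first by rewrite big_ord0.
by rewrite big_ord_recl /= subn0 factS -IH.
Qed.

(** The gaps below [3 * n] are the integers from 1 to 3n + 1 congruent to 0 or 2 modulo 3, those
    below [3 * n + 1] the ones congruent to 0 or 1. Together they give the factorial, with the
    multiples of 3 a second time. *)
Lemma prod_expo_gaps n :
  \prod_(i < n.*2) (expo n.*2 - expo i)
    * \prod_(i < n.*2.+1) (expo n.*2.+1 - expo i) =
  (3 * n + 1)`! * 3 ^ n * n`!.
Proof.
have expoD2 j : expo j.+2 = expo j + 3 by rewrite /expo /=; lia.
elim: n => [|n IH]; first by rewrite big_ord0 big_ord_recl big_ord0.
have shift m : \prod_(i < m.+2) (expo m.+2 - expo i) =
    (expo m + 3) * (expo m + 2) * \prod_(i < m) (expo m - expo i).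
  rewrite !big_ord_recl /= mulnA expoD2; congr (_ * _ * _).
  - by rewrite /expo /bump /=; lia.
  - by rewrite /expo /bump /=; lia.
  apply: eq_bigr => i _; rewrite /= /bump /= !add1n expoD2; lia.
rewrite doubleS !shift mulnACA IH.
rewrite (_ : 3 * n.+1 + 1 = (3 * n + 1).+3); last by lia.
rewrite !factS expnS.
rewrite (_ : expo n.*2 = 3 * n); last by rewrite /expo; lia.
rewrite (_ : expo n.*2.+1 = 3 * n + 1); last by rewrite /expo; lia.
ring.
Qed.

Lemma gap_prod_expo n :
  gap_prod expo n.*2 * \prod_(p < n) (n + p)`! =
  3 ^ 'C(n, 2) * \prod_(p < n) (3 * p + 1)`! * gap_prod id n.*2.
Proof.
elim: n => [|n IH]; first by rewrite /gap_prod !big_ord0.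
have facts : \prod_(p < n.+1) (n.+1 + p)`! * n`! =
    \prod_(p < n) (n + p)`! * (n.*2)`! * (n.*2.+1)`!.
  transitivity (\prod_(p < n.+2) (n + p)`!); last first.
    by rewrite 2!big_ord_recr /= addnS addnn.
  rewrite [RHS]big_ord_recl addn0 mulnC; congr (_ * _).
  by apply: eq_bigr => i _; rewrite /= /bump /= addnA addn1.
apply/eqP; rewrite -(eqn_pmul2r (fact_gt0 n)) -mulnA facts; apply/eqP.
rewrite doubleS !gap_prod_idS !gap_prodS [\prod_(p < n.+1) (3 * p +
  1)`!]big_ord_recr /= binS bin1 expnD.
have := prod_expo_gaps n.
move: IH; set g := gap_prod expo _; set b := \prod_(p < n) _.
set c := \prod_(p < n) (3 * p + 1)`!; set u := \prod_(i < n.*2) _.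
set v := \prod_(i < n.*2.+1) _ => IH uv.
transitivity (g * b * (u * v) * (n.*2)`! * (n.*2.+1)`!); first by ring.
by rewrite IH uv; ring.
Qed.

End GapProducts.

(** * Counting alternating sign matrices *)

(** The offset [c] is what the line has summed up before: in the rows already removed, or in the
    preceding layer of a chain. *)
Definition partial_sums_ok n (c : int) (F : 'I_n -> int) : bool :=
  [forall m : 'I_n, c + \sum_(j < n | (j <= m)%N) F j \in [:: 0; 1]].

Definition line_ok n (c : int) (F : 'I_n -> int) : bool :=
  partial_sums_ok c F && (c + \sum_(j < n) F j == 1).

Lemma forall_ordS n (P : pred 'I_n.+1) :
  [forall i, P i] = P ord0 && [forall i, P (lift ord0 i)].
Proof.
apply/forallP/andP => [PP|[P0 /forallP PS] i].
  by split; [|apply/forallP].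
by case: (unliftP ord0 i) => [j ->|->].
Qed.

Lemma eq_partial_sums_ok n c (F G : 'I_n -> int) :
  F =1 G -> partial_sums_ok c F = partial_sums_ok c G.
Proof.
by move=> FG; apply: eq_forallb => m; rewrite (eq_bigr _ (fun j _ => FG j)).
Qed.

Lemma eq_line_ok n c (F G : 'I_n -> int) : F =1 G -> line_ok c F = line_ok c G.
Proof.
by move=> FG; rewrite /line_ok (eq_partial_sums_ok _ FG) (eq_bigr _ (fun j _ =>
  FG j)).
Qed.

Lemma line_okS n c (F : 'I_n.+1 -> int) :
  line_ok c F =
  (c + F ord0 \in [:: 0; 1]) && line_ok (c + F ord0) (fun j => F (lift ord0 j)).
Proof.
rewrite /line_ok /partial_sums_ok forall_ordS -andbA; congr [&& _, _ & _].
- rewrite big_mkcond big_ord_recl /= big1 ?addr0 // => j _.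
- apply: eq_forallb => m; rewrite big_mkcond big_ord_recl /= addrA.
  by rewrite [in RHS]big_mkcond.
- by rewrite big_ord_recl addrA.
Qed.

Lemma line_ok0 c (F : 'I_0 -> int) : line_ok c F = (c == 1).
Proof.
rewrite /line_ok big_ord0 addr0 andb_idl // => _.
by apply/forallP => -[].
Qed.

(** The six-vertex row with all weights 1; the test is the vertex rule [b - a = g - h] without
    subtraction. *)
Fixpoint row_count (h : bool) (s t : seq bool) : nat :=
  match s, t with
  | [::], [::] => h
  | a :: s', b :: t' => \sum_(g : bool) (h + b == g + a)%N * row_count g s' t'
  | _, _ => 0
  end.

Fixpoint path_count (m n : nat) (s : seq bool) : nat :=
  if m is m'.+1 then
    (\sum_(t : n.-tuple bool) row_count false s t * path_count m' n t)%N
  else all id s.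

(** The horizontal edges are the partial sums of the row [t - s], so at most one choice of them
    contributes. *)
Lemma row_count_line n h (s t : n.-tuple bool) :
  row_count h s t =
  line_ok (Posz h) (fun j => Posz (tnth t j) - Posz (tnth s j)).
Proof.
elim: n h s t => [|n IH] h s t.
  by rewrite (tuple0 s) (tuple0 t) line_ok0; case: h.
case/tupleP: s => a s; case/tupleP: t => b t.
rewrite line_okS !tnth0 /= big_bool /= !IH.
rewrite (@eq_line_ok _ _ _ (fun j => Posz (tnth t j) - Posz (tnth s j))) =>
  [|j].
  by case: h a b => [] [] []; rewrite /= ?mul0n ?mul1n ?addn0.
by rewrite !tnthS.
Qed.

Section Ones.

Variables (R : comNzRingType) (w : R).

(** At [x = y = 1] all six vertex weights equal [w - w ^+ 2]. *)
Lemma row_weight_ones n h s t : size s = n -> size t = n ->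
  row_weight w 1 (nseq n 1) h s t = (w - w ^+ 2) ^+ n * (row_count h s t)%:R.
Proof.
elim: n h s t => [|n IH] h [|a s] [|b t] //=; first by rewrite mul1r.
case=> sz_s [sz_t]; rewrite natr_sum mulr_sumr; apply: eq_bigr => g _.
rewrite IH // (exprS _ n) natrM mulrACA; congr (_ * _).
by case: h a b g => [] [] [] []; rewrite /= ?mulr1 ?mulr0.
Qed.

Lemma partition_fun_path_count m n s : size s = n ->
  partition_fun w (nseq m 1) (nseq n 1) s =
  (w - w ^+ 2) ^+ (m * n) * (path_count m n s)%:R.
Proof.
elim: m s => [|m IH] s sz_s /=; first by rewrite mul1r.
rewrite size_nseq natr_sum mulr_sumr; apply: eq_bigr => t _.
rewrite row_weight_ones ?size_tuple // IH ?size_tuple //.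
by rewrite mulSn exprD natrM; ring.
Qed.

End Ones.

(** The possible last [m] rows of an alternating sign matrix whose earlier rows have column sums
    [s]. *)
Definition asm_from m n (s : n.-tuple bool) : {set 'M[asm_entry]_(m, n)} :=
  [set A : 'M[asm_entry]_(m, n) | [forall i, line_ok 0 (fun j =>
    val (A i j))] &&
           [forall j, line_ok (Posz (tnth s j)) (fun i => val (A i j))]].

(** The default -1 for values outside the entry set never arises: every argument in use is -1, 0 or
    1. *)
Definition entry_of (z : int) : asm_entry :=
  insubd (SeqSub (mem_head (-1 : int) [:: 0; 1]) : asm_entry) z.

Lemma entry_of_diff (a b : bool) :
  val (entry_of (Posz b - Posz a)) = Posz b - Posz a.
Proof. by rewrite val_insubd; case: a b => [] []. Qed.

(** The first row is forced to be [t - s]; if it is admissible, deleting it is a bijection onto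
    [asm_from m t]. *)
Lemma card_asm_from_row m n (s t : n.-tuple bool) :
  #|[set A in asm_from m.+1 s | [forall j, Posz (tnth s j) + val (A ord0 j) ==
    Posz (tnth t j)]]| =
  (row_count false s t * #|asm_from m t|)%N.
Proof.
pose add_row (A : 'M[asm_entry]_(m, n)) : 'M[asm_entry]_(m.+1, n) :=
  \matrix_(i, j) oapp (fun i' => A i' j)
    (entry_of (Posz (tnth t j) - Posz (tnth s j))) (unlift ord0 i).
have add_row0 A j : val (add_row A ord0 j) = Posz (tnth t j) - Posz (tnth s j).
  by rewrite mxE unlift_none /= entry_of_diff.
have add_rowS A i j : add_row A (lift ord0 i) j = A i j.
  by rewrite mxE liftK.
have add_row_inj : injective add_row.
  by move=> A B AB; apply/matrixP => i j; rewrite -!add_rowS AB.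
have add_row_in A : (add_row A \in asm_from m.+1 s) =
    line_ok 0 (fun j => Posz (tnth t j) - Posz (tnth s j)) && (A \in asm_from m
      t).
  rewrite !inE forall_ordS -andbA; congr [&& _, _ & _].
  - exact: eq_line_ok.
  - by apply: eq_forallb => i; apply: eq_line_ok => j; rewrite add_rowS.
  - apply: eq_forallb => j; rewrite line_okS add_row0 addrC subrK.
    rewrite (@eq_line_ok _ _ _ (fun i => val (A i j))) => [|i];
      last by rewrite add_rowS.
    by case: (tnth t j).
rewrite row_count_line.
set ok := line_ok _ _ in add_row_in *.
have -> : [set A in asm_from m.+1 s |
      [forall j, Posz (tnth s j) + val (A ord0 j) == Posz (tnth t j)]] =
    add_row @: [set B in asm_from m t | ok].
  apply/setP => A; rewrite inE; apply/andP/imsetP =>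
    [[A_asm /forallP A_row]|[B]].
    have A_def : A = add_row (row' ord0 A).
      apply/matrixP => i j; case: (unliftP ord0 i) => [i' ->|->].
        by rewrite add_rowS mxE.
      by apply: val_inj; rewrite add_row0 -(eqP (A_row j)) addrC addKr.
    exists (row' ord0 A) => //.
    by move: A_asm; rewrite {1}A_def add_row_in => /andP[row_ok rows_ok];
      rewrite inE rows_ok.
  rewrite inE andbC -add_row_in => B_asm ->; split=> //.
  by apply/forallP => j; rewrite add_row0 addrC subrK.
rewrite card_imset //; case: ok {add_row_in}.
  by rewrite mul1n; apply: eq_card => A; rewrite inE andbT.
by rewrite mul0n; apply: eq_card0 => A; rewrite inE andbF.
Qed.

Lemma card_asm_from m n (s : n.-tuple bool) : #|asm_from m s| = path_count m n
  s.
Proof.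
elim: m s => [|m IH] s /=.
  have -> : asm_from 0 s = if all id s then setT else set0.
    apply/setP => A; rewrite inE (_ : [forall i, _] = true) /=; last first.
      by apply/forallP => -[].
    rewrite (_ : [forall j, _] = all id s); first by case: (all id s) => /=;
      rewrite ?in_setT ?in_set0.
    apply/forallP/all_tnthP => all_s j; first by have := all_s j;
      rewrite line_ok0; case: (tnth s j).
    by have := all_s j; rewrite line_ok0; case: (tnth s j).
  by case: (all id s); rewrite ?cardsT ?card_mx ?mul0n ?expn0 ?cards0.
rewrite -sum1_card.
pose next (A : 'M[asm_entry]_(m.+1, n)) : n.-tuple bool :=
  [tuple Posz (tnth s j) + val (A ord0 j) == 1 | j < n].
rewrite (partition_big next xpredT) //=; apply: eq_bigr => t _.
rewrite -IH -card_asm_from_row -sum1_card; apply: eq_bigl => A.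
rewrite inE; apply: andb_id2l; rewrite inE => /andP[_ /forallP cols].
apply/eqP/forallP => [<- j|next_t].
  rewrite tnth_mktuple; have := cols j; rewrite line_okS => /andP[+ _].
  by rewrite !inE => /orP[] /eqP ->.
by apply: eq_from_tnth => j; rewrite tnth_mktuple (eqP (next_t j));
  case: (tnth t j).
Qed.

Definition asm_set n : {set 'M[asm_entry]_n} := asm_from n (nseq_tuple n false).

(** The two evaluations of the partition function at ones are compared in [algC] and combined with
    [gap_prod_expo]. *)
Theorem card_asm_set n :
  (#|asm_set n| * \prod_(p < n) (n + p)`! = \prod_(p < n) (3 * p + 1)`!)%N.
Proof.
have [w w_prim] := C_prim_root_exists (isT : (0 < 3)%N).
have w_neq1 : w != 1.
  by rewrite -[w]expr1 -(prim_order_dvd w_prim).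
have w_root : w ^+ 2 + w + 1 = 0.
  apply: (mulfI (x := w - 1)); first by rewrite subr_eq0.
  by rewrite mulr0 -[RHS](subrr 1) -{3}(prim_expr_order w_prim); ring.
have w2_neq1 : w ^+ 2 != 1 by rewrite -(prim_order_dvd w_prim).
pose th := w - w ^+ 2.
have th2 : th ^+ 2 = - 3%:R.
  have w2 : w ^+ 2 = - w - 1 by rewrite -[LHS]subr0 -w_root; ring.
  by rewrite /th; ring: w2.
have th_neq0 : th != 0.
  apply: contra_eq_neq th2 => ->; rewrite expr0n eq_sym oppr_eq0.
  by rewrite pnatr_eq0.
(* Here n * n = n + 2 * C(n, 2); the power of -3 will absorb both the sign in [alternant_const] and
   the power of 3 in [gap_prod_expo]. *)
have th_sq : th ^+ (n * n) = th ^+ n * (- 3%:R) ^+ 'C(n, 2).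
  rewrite -th2 -exprM -exprD; congr (_ ^+ _).
  by elim: n => // k IH; rewrite binS bin1; lia.
have := partition_fun_ones w_root w2_neq1 n.
rewrite (partition_fun_path_count _ _ (s := nseq_tuple n false)) ?size_tuple //.
rewrite -(card_asm_from n (nseq_tuple n false)) -/(asm_set n).
rewrite /alternant_const -/th th_sq => ones.
have := congr1 (fun k => k%:R : algC) (gap_prod_expo n).
rewrite !natrM natrX.
set N := (#|_|%:R : algC) in ones *; set G := (gap_prod id _)%:R in ones *.
set L := (gap_prod expo _)%:R in ones *.
move=> prods; apply/eqP; rewrite -(eqr_nat algC) natrM -/N; apply/eqP.
have cancel_neq0 : th ^+ n * (- 3%:R) ^+ 'C(n, 2) * G != 0.
  rewrite !mulf_neq0 ?expf_neq0 ?oppr_eq0 ?pnatr_eq0 // -lt0n.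
  elim: (n.*2) => [|k IH]; first by rewrite /gap_prod big_ord0.
  by rewrite gap_prod_idS muln_gt0 IH fact_gt0.
apply: (mulfI cancel_neq0).
set B := (\prod_(p < n) (n + p)`!)%N%:R in prods *.
set D := (\prod_(p < n) (3 * p + 1)`!)%N%:R in prods *.
transitivity (th ^+ n * (- 3%:R) ^+ 'C(n, 2) * N * G * B); first by ring.
rewrite ones; transitivity (th ^+ n * (-1) ^+ 'C(n, 2) * (L * B));
  first by ring.
by rewrite prods -[- 3%:R]mulN1r exprMn; ring.
Qed.

(** * Chains *)

Lemma in01P (z : int) : reflect (0 <= z <= 1) (z \in [:: 0; 1]).
Proof. by rewrite !inE; apply: (iffP idP); lia. Qed.

Lemma partial_sums_ok_total n c (F : 'I_n -> int) :
  (0 < n)%N -> partial_sums_ok c F -> 0 <= c + \sum_(j < n) F j <= 1.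
Proof.
case: n F => // n F _ /forallP /(_ ord_max) /in01P.
by rewrite (eq_bigl xpredT) // => j; rewrite -ltnS ltn_ord.
Qed.

Lemma sum_eq_card (n : nat) (F : 'I_n -> int) :
  (forall i, F i <= 1) -> \sum_i F i = n%:Z -> forall i, F i = 1.
Proof.
move=> F1 sumF i; apply/eqP; rewrite eq_sym -subr_eq0; apply/eqP.
have F_ge0 j : true -> 0 <= 1 - F j by rewrite subr_ge0.
apply: (psumr_eq0P F_ge0) => //.
by rewrite sumrB sumF sumr_const card_ord natz subrr.
Qed.

Lemma sum_rev_ord (n : nat) (F : 'I_n -> int) :
  \sum_(j < n) F (rev_ord j) = \sum_(j < n) F j.
Proof. by rewrite [RHS](reindex_inj rev_ord_inj). Qed.

Definition asm_upwards n : {set 'M[asm_entry]_n} :=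
  [set A : 'M[asm_entry]_n | [forall i, line_ok 0 (fun j => val (A i j))] &&
           [forall j, line_ok 0 (fun i => val (A (rev_ord i) j))]].

Lemma card_asm_upwards n : #|asm_upwards n| = #|asm_set n|.
Proof.
pose flip (A : 'M[asm_entry]_n) : 'M[asm_entry]_n := \matrix_(i, j) A (rev_ord
  i) j.
have flipK : involutive flip.
  by move=> A; apply/matrixP => i j; rewrite !mxE rev_ordK.
rewrite -(card_imset _ (inv_inj flipK)); apply: eq_card => A.
rewrite -[A in LHS]flipK (mem_imset _ _ (inv_inj flipK)) !inE; congr (_ && _).
  apply/forallP/forallP => rows i; have := rows (rev_ord i).
    rewrite (@eq_line_ok _ _ _ (fun j => val (A i j))) // => j.
    by rewrite mxE rev_ordK.
  by move=> ok; rewrite (@eq_line_ok _ _ _ (fun j => val (A (rev_ord i) j)))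
    // => j; rewrite mxE.
apply: eq_forallb => j; rewrite tnth_nseq.
by apply: eq_line_ok => i; rewrite mxE rev_ordK.
Qed.

Section Chains.

Variables (n m : nat).
Hypothesis n_gt0 : (0 < n)%N.
Let k := m.*2.+1.

(** [l] counts from 0, so an odd [l] is a layer of even number in the numbering of [layer]. *)
Definition alternating (A : k.-tuple 'M[asm_entry]_n) : bool :=
  [forall l : 'I_k, if odd l then tnth A l == const_mx (entry_of 0)
                    else tnth A l \in asm_upwards n].

Lemma layerS (A : k.-tuple 'M[asm_entry]_n) (l : 'I_k) i j :
  layer A l.+1 i j = val (tnth A l i j).
Proof.
rewrite /layer /= (nth_map (tnth A l)) ?size_tuple // mxE.
by rewrite -tnth_nth.
Qed.

Lemma layer0 (A : k.-tuple 'M[asm_entry]_n) i j : layer A 0 i j = 0.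
Proof. by rewrite mxE. Qed.

Lemma chain_conditionsP (A : k.-tuple 'M[asm_entry]_n) :
  reflect (forall l : 'I_k,
    (forall i, partial_sums_ok 0 (fun j => layer A l.+1 i j)) /\
    (forall i, partial_sums_ok (\sum_j layer A l i j)
       (fun j => layer A l.+1 (rev_ord j) i)))
  (chain_conditions A).
Proof.
apply: (iffP andP) => [[/forallP rows /forallP cols] l|chain].
  split=> i; apply/forallP => r; have /forallP := rows l;
    have /forallP := cols l.
    by move=> _ /(_ i) /forallP /(_ r); rewrite add0r.
  by move=> /(_ i) /forallP /(_ r).
split; apply/forallP => l; have [rows cols] := chain l;
  apply/forallP => i; apply/forallP => r.
  by have /forallP /(_ r) := rows i; rewrite add0r.
by have /forallP /(_ r) := cols i.
Qed.

Definition layer_sum (A : k.-tuple 'M[asm_entry]_n) l : int :=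
  \sum_i \sum_j layer A l i j.

(** The column condition at full length bounds a row sum of one layer plus the matching column sum
    of the next by 1; this is summed over the [n] columns. *)
Lemma layer_sum_pair (A : k.-tuple 'M[asm_entry]_n) (l : 'I_k) :
  chain_conditions A ->
  0 <= layer_sum A l.+1 /\ layer_sum A l + layer_sum A l.+1 <= n%:Z.
Proof.
move=> /chain_conditionsP /(_ l) [rows cols]; split.
  apply: sumr_ge0 => i _.
  by have := partial_sums_ok_total n_gt0 (rows i); rewrite add0r => /andP[].
rewrite /layer_sum [X in _ + X]exchange_big -big_split /=.
rewrite -natz -[n in n%:R]card_ord -sumr_const; apply: ler_sum => i _.
have := partial_sums_ok_total n_gt0 (cols i).
by rewrite (sum_rev_ord (fun j => layer A l.+1 j i)) => /andP[].
Qed.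

Lemma sum_pairs_bound (T : nat -> int) r :
  T 0%N = 0 ->
  (forall l, (l < r.*2.+1)%N -> 0 <= T l.+1 /\ T l + T l.+1 <= n%:Z) ->
  \sum_(l < r.*2.+1) T l.+1 <= n%:Z *+ r.+1 /\
  (\sum_(l < r.*2.+1) T l.+1 = n%:Z *+ r.+1 ->
   forall l, (l < r.*2.+1)%N -> T l.+1 = if odd l then 0 else n%:Z).
Proof.
move=> T0; elim: r => [|r IH] T_pair.
  rewrite big_ord_recl big_ord0 addr0 mulr1n /=; split.
    by have := (T_pair 0%N isT).2; rewrite T0 add0r.
  by move=> T1 [|l].
have [] := IH; first by move=> l lr; apply: T_pair; lia.
set S := \sum_(l < r.*2.+1) T l.+1 => S_le S_eq.
rewrite doubleS 2!big_ord_recr /= -/S mulrSr.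
have [T2_ge T12] := T_pair r.*2.+1 ltac:(lia).
have [T3_ge T23] := T_pair r.*2.+2 ltac:(lia).
split; first by lia.
move=> sum_eq; have S_max : S = n%:Z *+ r.+1 by lia.
(* This forces the next term to be 0, and so the last one to be [n]. *)
have T1 : T r.*2.+1 = n%:Z.
  by rewrite (S_eq S_max r.*2) // odd_double.
move=> l; rewrite ltnS leq_eqVlt => /orP[/eqP->|].
  by rewrite /= odd_double /=; lia.
rewrite ltnS leq_eqVlt => /orP[/eqP->|]; last exact: S_eq.
by rewrite /= odd_double /=; lia.
Qed.

Lemma total_sum_bound (A : k.-tuple 'M[asm_entry]_n) :
  chain_conditions A ->
  total_sum A <= n%:Z *+ m.+1 /\
  (total_sum A = n%:Z *+ m.+1 ->
   forall l, (l < k)%N -> layer_sum A l.+1 = if odd l then 0 else n%:Z).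
Proof.
move=> chain; apply: sum_pairs_bound => [|l lk].
  by rewrite /layer_sum big1 // => i _; rewrite big1 // => j _; rewrite layer0.
exact: (layer_sum_pair (Ordinal lk)).
Qed.

Lemma alternating_chain (A : k.-tuple 'M[asm_entry]_n) :
  alternating A -> chain_conditions A /\ total_sum A = n%:Z *+ m.+1.
Proof.
move=> /forallP alt.
have layer_odd (l : 'I_k) i j : odd l -> layer A l.+1 i j = 0.
  by move=> l_odd; have := alt l; rewrite l_odd layerS => /eqP ->;
    rewrite mxE val_insubd.
have asm_even (l : 'I_k) : ~~ odd l -> tnth A l \in asm_upwards n.
  by move=> /negbTE l_even; have := alt l; rewrite l_even.
have row_even (l : 'I_k) i : ~~ odd l -> line_ok 0 (fun j => layer A l.+1 i j).
  move=> /asm_even; rewrite inE => /andP[/forallP /(_ i) + _].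
  by rewrite (@eq_line_ok _ _ _ (fun j => layer A l.+1 i j)) // => j;
    rewrite layerS.
have rowsum_even (l : 'I_k) i : ~~ odd l -> \sum_j layer A l.+1 i j = 1.
  by move=> /(row_even l i) /andP[_ /eqP]; rewrite add0r.
have col_even (l : 'I_k) j : ~~ odd l -> line_ok 0 (fun i =>
  layer A l.+1 (rev_ord i) j).
  move=> /asm_even; rewrite inE => /andP[_ /forallP /(_ j)].
  by rewrite (@eq_line_ok _ _ _ (fun i => layer A l.+1 (rev_ord i) j)) // => i;
    rewrite layerS.
split.
  apply/chain_conditionsP => l; case: (boolP (odd l)) => l_par; split=> i.
  - apply/forallP => r; rewrite big1 // => j _; exact: layer_odd.
  (* Above a zero layer the columns start from row sums 1 of an alternating sign matrix and stay at
     1. *)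
  - apply/forallP => r; rewrite [X in _ + X]big1 ?addr0 => [|j _];
      last exact: layer_odd.
    by case: l l_par => [[|l] lk] //= l_odd;
      rewrite (rowsum_even (Ordinal (ltnW lk))).
  - by have /andP[] := row_even l i l_par.
  - rewrite (_ : \sum_j _ = 0); first by have /andP[] := col_even l i l_par.
    apply: big1 => j _; case: l l_par => [[|l] lk] /=; first by rewrite layer0.
    by rewrite negbK => l_odd; apply: (layer_odd (Ordinal (ltnW lk))).
have sums (l : 'I_k) : layer_sum A l.+1 = if odd l then 0 else n%:Z.
  rewrite /layer_sum; case: (boolP (odd l)) => l_par.
    by rewrite big1 // => i _; rewrite big1 // => j _; apply: layer_odd.
  rewrite (eq_bigr (fun => 1)) => [|i _]; last exact: rowsum_even.
  by rewrite sumr_const card_ord natz.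
rewrite /total_sum (eq_bigr _ (fun l _ => sums l)) {}/k; clear.
elim: m => [|r IH]; first by rewrite big_ord_recl big_ord0 addr0.
by rewrite doubleS 2!big_ord_recr /= odd_double /= IH addr0 [RHS]mulrSr.
Qed.

(** This shows that the bound on the total sum is attained; the antidiagonal matrix serves for every
    nonzero layer. *)
Lemma alternating_exists : exists A : k.-tuple 'M[asm_entry]_n, alternating A.
Proof.
pose unit_mx : 'M[asm_entry]_n := \matrix_(i, j) entry_of (rev_ord i == j)%:Z.
exists [tuple if odd l then const_mx (entry_of 0) else unit_mx | l < k].
apply/forallP => l; rewrite tnth_mktuple; case: (odd l); first exact: eqxx.
have entry_b (b : bool) : val (entry_of b%:Z) = b%:Z by rewrite val_insubd;
  case: b.
have line (i : 'I_n) : line_ok 0 (fun j => (i == j)%:Z).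
  rewrite /line_ok add0r; apply/andP; split.
    apply/forallP => r; rewrite add0r big_mkcond (bigD1 i) //= big1 => [|j ji].
      by rewrite eqxx addr0; case: ifP.
    by rewrite eq_sym (negbTE ji) if_same.
  by rewrite (bigD1 i) //= big1 ?eqxx // => j ji; rewrite eq_sym (negbTE ji).
rewrite inE; apply/andP; split; apply/forallP => i.
  by rewrite (@eq_line_ok _ _ _ (fun j => (rev_ord i == j)%:Z)) // => j;
    rewrite mxE entry_b.
rewrite (@eq_line_ok _ _ _ (fun j => (i == j)%:Z)) // => j.
by rewrite mxE entry_b rev_ordK eq_sym.
Qed.

(* In the first nonzero column the entries are row partial sums, hence
   nonnegative. *)
Lemma zero_layer (M : 'M[int]_n) :
  (forall i, partial_sums_ok 0 (fun j => M i j)) ->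
  (forall j, \sum_i M i j <= 0) -> M = 0.
Proof.
move=> rows cols; apply/matrixP => i j; rewrite mxE; move: i.
have [r] := ubnP j; elim: r j => // r IH j; rewrite ltnS => jr i.
have entry_ge0 i' : 0 <= M i' j.
  have /forallP /(_ j) /in01P := rows i'.
  rewrite add0r (bigD1 j) //= big1 => [|j' /andP[j'j ne]];
    first by rewrite addr0 => /andP[].
  by apply: IH; apply: leq_trans jr; rewrite ltn_neqAle ne.
apply: (psumr_eq0P (P := xpredT) (F := fun i => M i j)) => //.
by apply/eqP; rewrite eq_le cols sumr_ge0.
Qed.

(** Maximality fixes all layer sums, and since row sums lie between 0 and 1, a layer sum [n] or 0
    fixes each row sum. *)
Lemma maximal_alternating (A : k.-tuple 'M[asm_entry]_n) :
  chain_conditions A -> total_sum A = n%:Z *+ m.+1 -> alternating A.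
Proof.
move=> chain A_max; have [_ /(_ A_max) sums] := total_sum_bound chain.
have /chain_conditionsP lines := chain.
have rowsum (l : 'I_k) i : 0 <= \sum_j layer A l.+1 i j <= 1.
  by have := partial_sums_ok_total n_gt0 ((lines l).1 i); rewrite add0r.
have rowsum_even l i : (l < k)%N -> ~~ odd l -> \sum_j layer A l.+1 i j = 1.
  move=> lk l_even; apply: (sum_eq_card (F := fun i =>
    \sum_j layer A l.+1 i j)).
    by move=> i'; have /andP[] := rowsum (Ordinal lk) i'.
  by have := sums l lk; rewrite (negbTE l_even).
have rowsum_odd l i : (l < k)%N -> odd l -> \sum_j layer A l.+1 i j = 0.
  move=> lk l_odd.
  apply: (psumr_eq0P (P := xpredT) (F := fun i => \sum_j layer A l.+1 i j)) =>
    //.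
    by move=> i' _; have /andP[] := rowsum (Ordinal lk) i'.
  by have := sums l lk; rewrite l_odd.
apply/forallP => l; have [rows cols] := lines l; case: (boolP (odd l)) => l_par.
  have zero : map_mx val (tnth A l) = 0 :> 'M[int]_n.
    apply: zero_layer => [i|j].
      rewrite (@eq_partial_sums_ok _ _ _ (fun j => layer A l.+1 i j)) // => j.
      by rewrite layerS mxE.
    (* The preceding row sum is already 1, which leaves a column sum of at most 0. *)
    have := partial_sums_ok_total n_gt0 (cols j) => /andP[_].
    rewrite (sum_rev_ord (fun i => layer A l.+1 i j)).
    case: l l_par {rows cols} => [[|l] lk] //= l_odd.
    rewrite rowsum_even ?(ltnW lk) //.
    rewrite -[X in _ <= X]addr0 lerD2l; congr (_ <= 0); apply: eq_bigr => i _.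
    by rewrite (layerS A (Ordinal lk)) mxE.
  apply/eqP/matrixP => i j; apply: val_inj; rewrite mxE val_insubd /=.
  by have /matrixP /(_ i j) := zero; rewrite !mxE.
rewrite inE; apply/andP; split; apply/forallP => i; last first.
  rewrite (@eq_line_ok _ _ _ (fun j => layer A l.+1 (rev_ord j) i)) => [|j];
    last by rewrite layerS.
  (* The columns start from 0, so their sums are at most 1; as these add up to [n], each is 1. *)
  have prev0 i' : \sum_j layer A l i' j = 0.
    case: l l_par {rows cols} => [[|l] lk] /=; first by rewrite big1 // => j _;
      rewrite layer0.
    by rewrite negbK => l_odd; apply: rowsum_odd => //; apply: ltnW.
  have := cols i; rewrite prev0 /line_ok => -> /=; rewrite add0r.
  rewrite (sum_rev_ord (fun j => layer A l.+1 j i)); apply/eqP.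
  apply: (sum_eq_card (F := fun i => \sum_j layer A l.+1 j i)) => [i'|].
    have := partial_sums_ok_total n_gt0 (cols i'); rewrite prev0 add0r.
    by rewrite (sum_rev_ord (fun j => layer A l.+1 j i')) => /andP[].
  by rewrite exchange_big; have := sums l (ltn_ord l); rewrite (negbTE l_par).
rewrite (@eq_line_ok _ _ _ (fun j => layer A l.+1 i j)) => [|j];
  last by rewrite layerS.
by rewrite /line_ok rows add0r rowsum_even /=.
Qed.

Lemma linear_chained_ASM_alternating :
  linear_chained_ASM n k = [set A | alternating A].
Proof.
apply/setP => A; rewrite !inE; apply/andP/idP => [[chain /forallP A_max]|alt].
  apply: maximal_alternating => //; have [B /alternating_chain[B_chain B_sum]]
    := alternating_exists.
  have [A_le _] := total_sum_bound chain; apply/eqP; rewrite eq_le A_le -B_sum.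
  exact: (implyP (A_max B)).
have [chain ->] := alternating_chain alt; split=> //.
by apply/forallP => B; apply/implyP => /total_sum_bound[].
Qed.

End Chains.

Lemma card_tuple_family (T : finType) k (P : nat -> pred T) :
  #|[set A : k.-tuple T | [forall l : 'I_k, P l (tnth A l)]]| =
  (\prod_(l < k) #|P l|)%N.
Proof.
pose f (g : {ffun 'I_k -> T}) : k.-tuple T := [tuple g l | l < k].
have f_inj : injective f.
  by move=> g h gh; apply/ffunP => l; rewrite -[g l]tnth_mktuple -/(f g) gh
    tnth_mktuple.
have -> : [set A : k.-tuple T | [forall l : 'I_k, P l (tnth A l)]] =
    f @: [set g in family (fun l : 'I_k => P l)].
  apply/setP => A; rewrite inE; apply/forallP/imsetP => [A_P|[g] + -> l].
    exists [ffun l => tnth A l].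
      by rewrite inE; apply/familyP => l; rewrite ffunE; apply: A_P.
    by apply: eq_from_tnth => l; rewrite tnth_mktuple ffunE.
  by rewrite inE tnth_mktuple => /familyP /(_ l).
by rewrite card_imset // cardsE card_family foldrE big_map big_enum.
Qed.

Lemma card_linear_chained_ASM n m : (0 < n)%N ->
  #|linear_chained_ASM n m.*2.+1| = (#|asm_set n| ^ m.+1)%N.
Proof.
move=> n_gt0; rewrite linear_chained_ASM_alternating //.
pose P l : pred 'M[asm_entry]_n := fun M =>
  if odd l then M == const_mx (entry_of 0) else M \in asm_upwards n.
rewrite (card_tuple_family _ P).
have card_P l : #|P l| = if odd l then 1%N else #|asm_set n|.
  rewrite /P; case: (odd l); first exact: card1.
  by rewrite -card_asm_upwards; apply: eq_card.
under eq_bigr => l _ do rewrite card_P.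
elim: m => [|r IH]; first by rewrite big_ord_recl big_ord0 muln1.
by rewrite doubleS 2!big_ord_recr /= odd_double /= IH muln1 [RHS]expnSr.
Qed.

Theorem corollary4p10 (n k : nat) (hn : (1 <= n)%N) (hk : (1 <= k)%N)
    (k_odd : odd k) :
  (#|linear_chained_ASM n k|%:R : rat) =
    (\prod_(0 <= p < n) (((3 * p + 1)`!)%:R / ((n + p)`!)%:R))
      ^+ ((k + 1) %/ 2)%N.
Proof.
have [m ->] : exists m, k = m.*2.+1.
  by exists k./2; rewrite -[LHS]odd_double_half k_odd.
rewrite card_linear_chained_ASM // natrX (_ : (_ %/ 2)%N = m.+1); last by lia.
congr (_ ^+ _); rewrite big_mkord prodf_div -!natr_prod -card_asm_set natrM
  mulfK //.
by rewrite pnatr_eq0 -lt0n prodn_gt0 // => p; exact: fact_gt0.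
Qed.
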